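(* Let $(X,d)$ be a complete metric space, let $k\in\mathbb{N}$, and let $T:\prod_{l=1}^{\infty}X\to X$ be an extended Kannan-Geraghty $H_k$ contraction. Then there exists $u\in X$ such that $T(u,u,u,\ldots)=u$, and for any $x_1,\ldots,x_k\in X$ the infinite $k$-Picard sequence with respect to $T$ based on $\{x_1,\ldots,x_k\}$ converges to $u$.
   Context: $\mathbb{N}$ denotes the set of positive integers; metric spaces are nonempty. $\prod_{l=1}^{\infty}X$ is the set of all infinite sequences of points of $X$. For points $u_1,\ldots,u_k\in X$, write $(u_{i,\widehat{k}})_{i=1}^{\infty}:=(u_1,u_2,\ldots,u_{k-1},u_k,u_k,u_k,\ldots)$, the infinite tuple in which the $k$-th point is repeated forever. $\mathbb{G}$ denotes the set of all functions $\beta:[0,\infty)\to[0,1)$ such that, for every sequence $(t_n)$ in $[0,\infty)$, $\lim_{n\to\infty}\beta(t_n)=1$ implies $\lim_{n\to\infty}t_n=0$. Extended Kannan-Geraghty $H_k$ contraction: $T:\prod_{l=1}^{\infty}X\to X$ is so called if there is $\beta\in\mathbb{G}$ such that for all $u_1,\ldots,u_k,v_1,\ldots,v_k\in X$, $$d\big(T((u_{i,\widehat{k}})_{i=1}^{\infty}),T((v_{i,\widehat{k}})_{i=1}^{\infty})\big)\le\frac{\beta(d(u_k,v_k))}{2}\Big(d\big(T((u_{i,\widehat{k}})_{i=1}^{\infty}),u_k\big)+d\big(T((v_{i,\widehat{k}})_{i=1}^{\infty}),v_k\big)\Big).$$ Infinite $k$-Picard sequence: given $T:\prod_{l=1}^{\infty}X\to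 X$ and base points $x_1,\ldots,x_k\in X$, it is the sequence defined recursively by $x_{n+k}:=T(x_n,x_{n+1},\ldots,x_{n+k-2},x_{n+k-1},x_{n+k-1},x_{n+k-1},\ldots)$ for all $n\ge1$ (the entry $x_{n+k-1}$ is repeated forever). *)

(* Defs.v *)
From HB Require Import structures.
From mathcomp Require Import all_boot all_order all_algebra.
From mathcomp Require Import all_classical all_reals all_analysis.

Set Implicit Arguments.
Unset Strict Implicit.
Unset Printing Implicit Defensive.
Import Order.TTheory GRing.Theory Num.Theory.
Import numFieldNormedType.Exports.

Local Open Scope classical_set_scope.
Local Open Scope ring_scope.

(* [Complete] inherits from [Pointed], so these spaces are nonempty. *)
#[short(type="completeMetricType")]
HB.structure Definition CompleteMetric (R : numDomainType) :=
  {M of Metric R M & Complete M}.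

(* A function on [0, +oo[ is represented by a function on R of which only the
   values at nonnegative arguments are ever constrained or used. *)
Definition Geraghty (R : realType) (beta : R -> R) : Prop :=
  (forall t, 0 <= t -> 0 <= beta t < 1) /\
  (forall t : nat -> R, (forall n, 0 <= t n) ->
     beta (t n) @[n --> \oo] --> (1 : R) -> t n @[n --> \oo] --> (0 : R)).

Lemma pad_subproof (k : nat) (k_gt0 : (0 < k)%N) (i : nat) :
  (minn i k.-1 < k)%N.
Proof. by rewrite gtn_min prednK // leqnn orbT. Qed.

(* (u_1, ..., u_k, u_k, u_k, ...), with indices starting from 0. *)
Definition pad (X : Type) (k : nat) (k_gt0 : (0 < k)%N) (u : 'I_k -> X) :
    nat -> X :=
  fun i => u (Ordinal (pad_subproof k_gt0 i)).

Lemma last_point_subproof (k : nat) (k_gt0 : (0 < k)%N) : (k.-1 < k)%N.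
Proof. by rewrite prednK. Qed.

Definition last_point (X : Type) (k : nat) (k_gt0 : (0 < k)%N)
    (u : 'I_k -> X) : X :=
  u (Ordinal (last_point_subproof k_gt0)).

Definition Kannan_Geraghty (R : realType) (X : metricType R) (k : nat)
    (k_gt0 : (0 < k)%N) (T : (nat -> X) -> X) : Prop :=
  exists beta : R -> R, Geraghty beta /\
    forall u v : 'I_k -> X,
      let Tu := T (pad k_gt0 u) in
      let Tv := T (pad k_gt0 v) in
      let uk := last_point k_gt0 u in
      let vk := last_point k_gt0 v in
      mdist Tu Tv <= beta (mdist uk vk) / 2 * (mdist Tu uk + mdist Tv vk).

Section Picard.
Variables (X : Type) (k : nat) (k_gt0 : (0 < k)%N).
Variables (T : (nat -> X) -> X) (x : 'I_k -> X).

(* The k consecutive terms of the Picard sequence starting at index n; the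
   recursion equation it encodes is [picard_seq_rec] below. *)
Fixpoint picard_window (n : nat) : 'I_k -> X :=
  if n is m.+1 then
    fun i => if insub i.+1 is Some j then picard_window m j
             else T (pad k_gt0 (picard_window m))
  else x.

Definition picard_seq (n : nat) : X := picard_window n (Ordinal k_gt0).

Lemma picard_windowE n (i : 'I_k) : picard_window n i = picard_seq (n + i).
Proof.
case: i => i; elim: i n => [|i IHi] n ltik /=.
  by rewrite addn0; congr picard_window; apply: val_inj.
rewrite -addSnnS -(IHi n.+1 (ltnW ltik)) /=.
by rewrite (insubT (fun j => (j < k)%N) ltik).
Qed.

Lemma picard_seq_base (i : 'I_k) : picard_seq i = x i.
Proof. by rewrite -[val i]add0n -picard_windowE. Qed.

Lemma picard_seq_rec n :
  picard_seq (n + k) = T (pad k_gt0 (fun i : 'I_k => picard_seq (n + i))).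
Proof.
rewrite -[in LHS](prednK k_gt0) -addSnnS.
rewrite -(picard_windowE n.+1 (Ordinal (last_point_subproof k_gt0))) /=.
rewrite insubF ?prednK ?ltnn //.
by congr (T (pad k_gt0 _)); apply/funext => i; rewrite picard_windowE.
Qed.

End Picard.

(* Main.v *)
Require Import Defs.
From mathcomp Require Import all_boot all_order all_algebra.
From mathcomp Require Import all_classical all_reals all_analysis.
From mathcomp Require Import lra.
Set Implicit Arguments.
Unset Strict Implicit.
Import Order.TTheory GRing.Theory Num.Theory.
Import numFieldNormedType.Exports.
Local Open Scope classical_set_scope.
Local Open Scope ring_scope.

(** The value of [T] at a padded tuple and the last point of that tuple are all
that the contraction condition sees. Along a Picard sequence, these are two
consecutive terms, so the tail [z] starting at the last base point satisfies
[d (z n.+1) (z m.+1) <= beta (d (z n) (z m)) / 2 * (a n + a m)], where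
[a n] is the gap [d (z n.+1) (z n)]: the problem reduces to one about orbits.

Taking [m = n.+1] gives [a n.+1 <= beta (a n) * a n]. The gaps thus decrease to
some limit [l]; were [l] positive, the ratios [a n.+1 / a n], hence also
[beta (a n)], would tend to 1, and the Geraghty property would force [l = 0]
([Geraghty_cvg0]). Since [beta < 1], the distance between [z n.+1] and [z m.+1]
is at most the mean of two vanishing gaps: [z] is Cauchy
([Kannan_orbit_cvg]). Comparing the tuples of the sequence with the constant
tuple at the limit [u] yields, in the limit, [d (T u) u <= d (T u) u / 2], so
[u] is fixed ([Kannan_limit_fixed]). Two fixed points have no gaps, so the
contraction condition makes their distance zero, and all Picard sequences have
the same limit. *)

(** Collecting the later gap [t] on one side gives [(2 - b) * t <= b * s], whose
left side is at least [t] because [b <= 1]. *)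
Lemma Kannan_gap_le (R : realFieldType) (b s t : R) :
  0 <= t -> b <= 1 -> t <= b / 2 * (s + t) -> t <= b * s.
Proof.
move=> t0 b1 h; have : 0 <= (1 - b) * t by rewrite mulr_ge0 ?subr_ge0.
by nra.
Qed.

Lemma Geraghty_cvg0 (R : realType) (beta : R -> R) (a : nat -> R) :
  Geraghty beta -> (forall n, 0 <= a n) ->
  (forall n, a n.+1 <= beta (a n) * a n) -> a n @[n --> \oo] --> (0 : R).
Proof.
move=> [beta01 betaG] a0 aS.
have a_dec : nonincreasing_seq a.
  apply/nonincreasing_seqP => n; apply: (le_trans (aS n)).
  by rewrite ler_piMl // ltW //; case/andP: (beta01 _ (a0 n)).
have a_cvg : cvgn a.
  by apply: nonincreasing_is_cvgn => //; exists 0 => _ [n _ <-].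
have la := nonincreasing_cvgn_ge a_dec a_cvg.
have l0 : 0 <= limn a by apply: limr_ge => //; exact: nearW.
have [l_eq0|l_neq0] := eqVneq (limn a) 0; first by rewrite -l_eq0.
have l_gt0 : 0 < limn a by rewrite lt_neqAle eq_sym l_neq0.
apply: betaG => //.
(* As [a n >= limn a > 0], the defect [1 - beta (a n)] is at most
   [(a n - a n.+1) / limn a], which tends to 0. *)
apply: (@squeeze_cvgr _ _ _ _
  (fun n => 1 - (a n - a n.+1) / limn a) (fun=> 1)).
- apply: nearW => n; have /andP[_ b1] := beta01 _ (a0 n).
  rewrite (ltW b1) andbT lerBlDr -lerBlDl ler_pdivlMr //.
  have : 0 <= (1 - beta (a n)) * (a n - limn a).
    by rewrite mulr_ge0 // subr_ge0 // ltW.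
  by have := aS n; nra.
- rewrite -[X in _ --> X]subr0; apply: cvgB; first exact: cvg_cst.
  rewrite -[X in _ --> X](mul0r (limn a)^-1) -(subrr (limn a)).
  apply: cvgMr_tmp; apply: cvgB => //.
  by rewrite (cvg_shiftS a).
- exact: cvg_cst.
Qed.

Lemma Kannan_orbit_cvg (R : realType) (X : completeMetricType R)
    (beta : R -> R) (z : nat -> X) :
  Geraghty beta ->
  (forall n m, mdist (z n.+1) (z m.+1) <= beta (mdist (z n) (z m)) / 2 *
     (mdist (z n.+1) (z n) + mdist (z m.+1) (z m))) ->
  cvg (z n @[n --> \oo]).
Proof.
move=> hbeta hz; have [beta01 _] := hbeta.
pose a n := mdist (z n.+1) (z n).
have a0 n : 0 <= a n by exact: mdist_ge0.
have beta1 (x y : X) : beta (mdist x y) <= 1.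
  by case/andP: (beta01 _ (mdist_ge0 x y)) => _ /ltW.
have /cvgrPdist_lt a_cvg0 : a n @[n --> \oo] --> (0 : R).
  apply: (Geraghty_cvg0 hbeta) => // n.
  apply: Kannan_gap_le; [exact: a0|exact: beta1|].
  by have := hz n n.+1; rewrite (metric_sym (z n.+1)) (metric_sym (z n)).
apply/cauchy_cvgP/cauchy_ballP => e e0.
have [N _ aN] := a_cvg0 e e0.
have a_lt n : (N <= n)%N -> a n < e.
  by move=> /aN /=; rewrite sub0r normrN ger0_norm.
have zN n m : (N < n)%N -> (N < m)%N -> mdist (z n) (z m) < e.
  case: n m => [//|n] [//|m] /a_lt an /a_lt am.
  apply: (le_lt_trans (hz n m)); have := beta1 (z n) (z m).
  rewrite -/(a n) -/(a m) => b1.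
  have : 0 <= (1 - beta (mdist (z n) (z m))) * (a n + a m).
    by rewrite mulr_ge0 ?subr_ge0 ?addr_ge0.
  by nra.
exists (z @` [set n | (N < n)%N], z @` [set n | (N < n)%N]) => /=.
  by split; exists N.+1 => // n Nn; exists n.
by move=> _ [/= [n Nn <-] [m Nm <-]]; rewrite ballEmdist; exact: zN.
Qed.

(** The gap on the right is at most [d (z n.+1) u + d u (z n)], so letting [n]
grow leaves [d v u <= d v u / 2]. This serves with [v] the value of [T] at the
constant tuple [u] and with [beta] bounded by 1. *)
Lemma Kannan_limit_fixed (R : realType) (X : metricType R) (z : nat -> X)
    (u v : X) :
  z n @[n --> \oo] --> u ->
  (forall n, mdist v (z n.+1) <= 2^-1 * (mdist v u + mdist (z n.+1) (z n))) ->
  v = u.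
Proof.
move=> z_cvg hv; apply: mdist_positivity; apply/eqP/contraT => d_neq0.
have d0 : 0 < mdist v u by rewrite lt_neqAle eq_sym d_neq0 mdist_ge0.
(* If [z N] and [z N.+1] are within [e] of [u], the triangle inequality gives
   [d v u < d v u / 2 + 2 * e], absurd for [e = d v u / 4]. *)
have e0 : 0 < mdist v u / 4 by rewrite divr_gt0.
have [N _ zN] := metricType_numDomainType.cvgr_dist_lt z_cvg e0.
have := zN N (leqnn N); have := zN N.+1 (leqnSn N) => /= h1 h2.
have h3 := metric_triangle v (z N.+1) u.
have h4 := metric_triangle (z N.+1) u (z N).
have h5 := hv N; rewrite (metric_sym (z N.+1) u) in h3 h4.
by exfalso; lra.
Qed.

Section PicardSequences.
Context (R : realType) (X : completeMetricType R) (k : nat) (k_gt0 : (0 < k)%N).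
Context (T : (nat -> X) -> X) (hT : Kannan_Geraghty k_gt0 T).

Lemma Kannan_Geraghty_fixed_unique (u v : X) :
  T (fun=> u) = u -> T (fun=> v) = v -> u = v.
Proof.
move=> Tu Tv; have [beta [_ /(_ (fun=> u) (fun=> v))]] := hT.
rewrite /pad /last_point Tu Tv !mdistxx addr0 mulr0 => uv0.
by apply/mdist_positivity/eqP; rewrite eq_le uv0 mdist_ge0.
Qed.

Lemma picard_seq_cvg_fixed (x : 'I_k -> X) :
  exists u, T (fun=> u) = u /\ picard_seq k_gt0 T x n @[n --> \oo] --> u.
Proof.
have [beta [hbeta hd]] := hT; have [beta01 _] := hbeta.
(* The offset [k.-1] makes [z n] the last point of the window [w n]. *)
pose z n := picard_seq k_gt0 T x (n + k.-1).
pose w n (i : 'I_k) := picard_seq k_gt0 T x (n + i).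
have Tw n : T (pad k_gt0 (w n)) = z n.+1.
  by rewrite /z addSnnS prednK // picard_seq_rec.
have hz n m : mdist (z n.+1) (z m.+1) <= beta (mdist (z n) (z m)) / 2 *
    (mdist (z n.+1) (z n) + mdist (z m.+1) (z m)).
  by have := hd (w n) (w m); rewrite /= !Tw.
have /cvg_ex[u zu] := Kannan_orbit_cvg hbeta hz.
exists u; split; last by rewrite -(cvg_shiftn k.-1).
apply: Kannan_limit_fixed zu _ => n.
have := hd (fun=> u) (w n); rewrite /= Tw => /le_trans; apply.
apply: ler_wpM2r; first by rewrite addr_ge0 ?mdist_ge0.
rewrite ler_piMl // ltW //.
by case/andP: (beta01 _ (mdist_ge0 u (z n))).
Qed.

End PicardSequences.

Theorem theorem2p2 (R : realType) (X : completeMetricType R)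
    (k : nat) (k_gt0 : (0 < k)%N) (T : (nat -> X) -> X)
    (hT : Kannan_Geraghty k_gt0 T) :
  exists u : X, T (fun _ : nat => u) = u /\
    forall x : 'I_k -> X, picard_seq k_gt0 T x n @[n --> \oo] --> u.
Proof.
have [u [Tu _]] := picard_seq_cvg_fixed hT (fun=> point).
exists u; split=> // x.
have [v [Tv xv]] := picard_seq_cvg_fixed hT x.
by rewrite (Kannan_Geraghty_fixed_unique hT Tu Tv).
Qed.
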